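(* Let $r\ge3$ and $x\in\mathrm{proj}\,\Omega(\mathcal{T}_r)$. Then \[ g(\mathcal{T}_r,x)\le\left(\frac{x^r}{r!}\right)^{\frac{1}{r-1}}. \] Moreover, equality holds for all $x\in[0,(r-1)!/r^{r-2}]$.
   Context: An $r$-graph $\mathcal{H}$ is a finite vertex set $V(\mathcal{H})$ together with a set of $r$-element subsets of it (edges); $|\mathcal{H}|$ is the number of edges and $v(\mathcal{H})=|V(\mathcal{H})|$. The shadow is $\partial\mathcal{H}=\{A\in\binom{V(\mathcal{H})}{r-1}: A\subset B \text{ for some } B\in\mathcal{H}\}$. For a family $\mathcal{F}$ of $r$-graphs, $\mathcal{H}$ is $\mathcal{F}$-free if it contains no member of $\mathcal{F}$ as a (not necessarily induced) subgraph. The edge density is $d(\mathcal{H})=|\mathcal{H}|/\binom{v(\mathcal{H})}{r}$ and the shadow density is $d(\partial\mathcal{H})=|\partial\mathcal{H}|/\binom{v(\mathcal{H})}{r-1}$. A sequence $(\mathcal{H}_k)_{k\ge1}$ of $r$-graphs is good if $v(\mathcal{H}_k)\to\infty$ and both $\lim_k d(\mathcal{H}_k)$ and $\lim_k d(\partial\mathcal{H}_k)$ exist; it realizes $(x,y)\in[0,1]^2$ if $\lim_k d(\partial\mathcal{H}_k)=x$ and $\lim_k d(\mathcal{H}_k)=y$. The feasible region $\Omega(\mathcal{F})$ is the set of all $(x,y)\in[0,1]^2$ realized by some good sequence of $\mathcal{F}$-free $r$-graphs; it is closed. $\mathrm{proj}\,\Omega(\mathcal{F})=\{x: \exists y,\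 (x,y)\in\Omega(\mathcal{F})\}$ and $g(\mathcal{F},x)=\max\{y:(x,y)\in\Omega(\mathcal{F})\}$ for $x\in\mathrm{proj}\,\Omega(\mathcal{F})$. $\mathcal{T}_r$ is the collection of all $r$-graphs on at most $2r-1$ vertices with $3$ edges $A,B,C$ such that $A\triangle B\subset C$; an $r$-graph is cancellative iff it is $\mathcal{T}_r$-free. *)

(* Defs.v *)
From HB Require Import structures.
From mathcomp Require Import all_boot all_order all_algebra.
From mathcomp Require Import all_classical all_reals all_analysis.

Set Implicit Arguments.
Unset Strict Implicit.
Unset Printing Implicit Defensive.

Import Order.TTheory GRing.Theory Num.Theory.
Import numFieldNormedType.Exports.

Local Open Scope classical_set_scope.
Local Open Scope ring_scope.

Record rgraph (r : nat) := RGraph {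
  vertex : finType;
  edges : {set {set vertex}};
  edges_card : forall e : {set vertex}, e \in edges -> #|e| = r
}.

Definition shadow (r : nat) (H : rgraph r) : {set {set vertex H}} :=
  [set A : {set vertex H} |
     (#|A| == r.-1) && [exists B in edges H, A \subset B]]%SET.

Definition subgraph (r : nat) (F H : rgraph r) : Prop :=
  exists f : vertex F -> vertex H,
    injective f /\
    forall e : {set vertex F}, e \in edges F -> (f @: e)%SET \in edges H.

Definition rfamily (r : nat) := rgraph r -> Prop.

Definition family_free (r : nat) (F : rfamily r) (H : rgraph r) : Prop :=
  forall G : rgraph r, F G -> ~ subgraph G H.

(* The cardinality condition makes the three edges distinct. *)
Definition cancel_family (r : nat) : rfamily r := fun G =>
  (#|vertex G| <= 2 * r - 1)%N /\
  exists A B C : {set vertex G},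
    [/\ edges G = [set A; B; C]%SET,
        #|edges G| = 3%N
      & ((A :\: B) :|: (B :\: A))%SET \subset C].

Section Feasible.
Variable R : realType.

(* Division by zero gives density 0 when there are too few vertices; this is
   irrelevant for sequences whose number of vertices tends to infinity. *)
Definition edge_density (r : nat) (H : rgraph r) : R :=
  #|edges H|%:R / 'C(#|vertex H|, r)%:R.

Definition shadow_density (r : nat) (H : rgraph r) : R :=
  #|shadow H|%:R / 'C(#|vertex H|, r.-1)%:R.

Definition good (r : nat) (H : nat -> rgraph r) : Prop :=
  [/\ #|vertex (H k)| @[k --> \oo] --> \oo,
      cvg (edge_density (H k) @[k --> \oo])
    & cvg (shadow_density (H k) @[k --> \oo])].

Definition realizes (r : nat) (H : nat -> rgraph r) (p : R * R) : Prop :=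
  shadow_density (H k) @[k --> \oo] --> p.1 /\
  edge_density (H k) @[k --> \oo] --> p.2.

Definition feasible_region (r : nat) (F : rfamily r) : set (R * R) :=
  [set p | [/\ 0 <= p.1 <= 1, 0 <= p.2 <= 1
    & exists H : nat -> rgraph r,
        [/\ good H, forall k, family_free F (H k) & realizes H p]]].

Definition feasible_proj (r : nat) (F : rfamily r) : set R :=
  [set x | exists y, feasible_region F (x, y)].

Definition is_max (S : set R) (y : R) : Prop := S y /\ ubound S y.

(* On [feasible_proj F] the maximum exists: see [feasible_maxP] below. *)
Definition feasible_max (r : nat) (F : rfamily r) (x : R) : R :=
  xget 0 (is_max [set y | feasible_region F (x, y)]).

Lemma feasible_maxP (r : nat) (F : rfamily r) (x : R) :
  feasible_proj F x ->
  is_max [set y | feasible_region F (x, y)] (feasible_max F x).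
Proof.
move=> [y0 Hy0]; apply: xgetPex.
set S := [set y | _].
have S0 : S !=set0 by exists y0.
have S1 : ubound S 1 by move=> y [_ /andP[]].
have supS : has_sup S by split => //; exists 1.
exists (sup S); split; last exact: sup_upper_bound.
have x01 : 0 <= x <= 1 by case: Hy0.
have H n : exists G : rgraph r, [/\ (n <= #|vertex G|)%N, family_free F G,
    `|x - shadow_density G| < n.+1%:R^-1
  & `|sup S - edge_density G| < n.+1%:R^-1 + n.+1%:R^-1].
  have n0 : 0 < n.+1%:R^-1 :> R by rewrite invr_gt0.
  have [y Sy ltSy] := sup_adherent n0 supS.
  have leyS : y <= sup S by exact: sup_upper_bound.
  have [_ _ [G [[/cvgnyPge Gv _ _] Gf [/= Gx Gy]]]] := Sy.
  have [k [[k1 k2] k3]] : exists k, ((n <= #|vertex (G k)|)%N /\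
      `|x - shadow_density (G k)| < n.+1%:R^-1) /\
      `|y - edge_density (G k)| < n.+1%:R^-1.
    apply: (@filter_ex _ \oo); do 2?[apply: filterI]; first exact: Gv.
      by move/cvgrPdist_lt: Gx; apply.
    by move/cvgrPdist_lt: Gy; apply.
  exists (G k); split => //.
  rewrite -(subrKA y) (le_lt_trans (ler_normD _ _))// ltrD//.
  by rewrite ger0_norm ?subr_ge0// ltrBlDr addrC -ltrBlDr.
have [G HG] := choice H.
have cinv : @GRing.inv R n.+1%:R @[n --> \oo] --> 0 by exact: cvg_harmonic.
have Gx : shadow_density (G k) @[k --> \oo] --> x.
  apply/cvgrPdist_lt => e e0.
  near=> n; have [_ _ h _] := HG n; apply: (lt_trans h).
  near: n; exact: (cvgr_lt _ cinv e e0).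
have Gy : edge_density (G k) @[k --> \oo] --> sup S.
  apply/cvgrPdist_lt => e e0.
  have e20 : 0 < e / 2 by rewrite divr_gt0.
  near=> n; have [_ _ _ h] := HG n; apply: (lt_trans h).
  rewrite [e]splitr ltrD//; near: n; exact: (cvgr_lt _ cinv _ e20).
split => //=.
  apply/andP; split; last exact: ge_sup.
  apply: le_trans (sup_upper_bound supS Hy0).
  by case: Hy0 => _ /andP[].
exists G; split => //; last by move=> k; case: (HG k).
split; [|by apply/cvg_ex; exists (sup S)|by apply/cvg_ex; exists x].
apply/cvgnyPge => A; near=> n.
have [h _ _ _] := HG n; apply: leq_trans h.
near: n; exact: nbhs_infty_ge.
Unshelve. all: by end_near. Qed.

End Feasible.

(* Main.v *)
(* Let H be a cancellative r-graph. The links of the vertices of an edge are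
   pairwise disjoint subsets of the shadow, so the degrees satisfy
   sum_v d(v)^2 <= |H| |dH|. The links are again cancellative and
   sum_v |d(link v)| = (r-1) |dH|, so induction on r together with Bernoulli's
   inequality gives the exact bound r^r |H|^(r-1) <= |dH|^r, which passes to the
   limit densities. Equality holds for balanced complete r-partite r-graphs;
   adding isolated vertices to them realizes every x <= (r-1)!/r^(r-2). *)
From mathcomp Require Import all_boot all_order all_algebra.
From mathcomp Require Import ring lra zify.
Require Import Defs.

Set Implicit Arguments.
Unset Strict Implicit.
Unset Printing Implicit Defensive.

Import Order.TTheory GRing.Theory Num.Theory.
Local Open Scope ring_scope.

(** * Links and shadows of uniform cancellative set families *)

Section SetSystems.
Variable T : finType.
Implicit Types (G H : {set {set T}}) (A B C E : {set T}) (v w : T).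

Definition uniform (k : nat) H := forall A, A \in H -> #|A| = k.

Definition cancellative H := forall A B C, A \in H -> B \in H -> C \in H ->
  (A :\: B) :|: (B :\: A) \subset C -> A = B.

(** Bare set families let the induction pass to links without rebuilding an [rgraph]; [k] plays the
    role of [r.-1] in [shadow]. *)
Definition shadow_set (k : nat) H : {set {set T}} :=
  [set A : {set T} | (#|A| == k) && [exists B in H, A \subset B]]%SET.

Definition link v H : {set {set T}} :=
  [set A : {set T} | (v \notin A) && (v |: A \in H)]%SET.

Lemma link_uniform v k H : uniform k.+1 H -> uniform k (link v H).
Proof.
move=> uH A; rewrite inE => /andP[vA /uH].
by rewrite cardsU1 vA => -[].
Qed.

Lemma link_cancellative v H : cancellative H -> cancellative (link v H).
Proof.
move=> cH A B C; rewrite !inE => /andP[vA AH] /andP[vB BH] /andP[vC CH] sABC.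
have eqAB : v |: A = v |: B.
  apply: cH AH BH CH _; apply/subsetP => x; rewrite !inE.
  have [->|xv] //= := eqVneq x v.
  by move=> xAB; apply: (subsetP sABC); rewrite !inE.
by rewrite -(setU1K vA) eqAB setU1K.
Qed.

(** If [B] in the link contains [A], then [v |: B] in [H] contains [v |: A]. This bounds the shadow
    of a link by a degree in the shadow of [H]. *)
Lemma shadow_link_sub v k H :
  (shadow_set k (link v H) \subset link v (shadow_set k.+1 H))%SET.
Proof.
apply/subsetP => A; rewrite !inE => /andP[/eqP cA /existsP[B]].
rewrite inE -andbA => /and3P[vB BH sAB].
have vA : v \notin A by apply: contra vB; exact: (subsetP sAB).
rewrite vA cardsU1 vA cA eqxx /=; apply/existsP; exists (v |: B).
by rewrite BH setUS.
Qed.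

Lemma card_link v H : #|link v H| = #|[set A in H | v \in A]%SET|.
Proof.
have inj : {in link v H &, injective (fun A => v |: A)}.
  move=> A B; rewrite !inE => /andP[vA _] /andP[vB _] eqAB.
  by rewrite -(setU1K vA) eqAB setU1K.
rewrite -(card_in_imset inj); apply: eq_card => A; rewrite !inE.
apply/imsetP/andP => [[B]|[AH vA]].
  by rewrite inE => /andP[vB BH] ->; rewrite setU11.
by exists (A :\ v)%SET; rewrite ?inE ?eqxx setD1K.
Qed.

(** Double counting of incidences weighted by [f]. The constant 1 gives the handshake identity; the
    degree as weight gives the sum of squared degrees. *)
Lemma sum_link H (f : T -> nat) :
  (\sum_v f v * #|link v H| = \sum_(A in H) \sum_(v in A) f v)%N.
Proof.
rewrite (exchange_big_dep predT) //=; apply: eq_bigr => v _.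
rewrite card_link -sum1_card big_distrr /= muln1.
by apply: eq_bigl => A; rewrite inE.
Qed.

Lemma sum_card_link k H : uniform k H -> (\sum_v #|link v H| = k * #|H|)%N.
Proof.
move=> uH; rewrite -[LHS](eq_bigr _ (fun v _ => mul1n _)) sum_link.
rewrite -sum1_card big_distrr /=; apply: eq_bigr => A AH.
by rewrite sum1_card (uH _ AH) muln1.
Qed.

(* Links of distinct vertices v, w of E are disjoint: if A is in both, then the
   symmetric difference of v |: A and w |: A lies in E. *)
Lemma sum_edge_link k H E : uniform k.+1 H -> cancellative H -> E \in H ->
  (\sum_(v in E) #|link v H| <= #|shadow_set k H|)%N.
Proof.
move=> uH cH EH.
have sub v : {subset link v H <= shadow_set k H}.
  move=> A Av; rewrite inE (link_uniform uH Av) eqxx /=.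
  move: Av; rewrite inE => /andP[_ AH].
  by apply/existsP; exists (v |: A); rewrite AH subsetUr.
under eq_bigr => v _ do rewrite -sum1_card.
rewrite (exchange_big_dep (mem (shadow_set k H))) /=; last by move=> v A _ /sub.
rewrite -[X in (_ <= X)%N]sum1_card; apply: leq_sum => A _; rewrite sum1dep_card.
apply/card_le1_eqP => v w; rewrite !inE => /andP[vE /andP[vA vH]].
move=> /andP[wE /andP[wA wH]].
have eqvw : v |: A = w |: A.
  apply: cH vH wH EH _; apply/subsetP => x; rewrite !inE.
  case: (x \in A); rewrite ?orbT ?orbF //=.
  by case/orP => /andP[_ /eqP->].
have : v \in w |: A by rewrite -eqvw setU11.
by rewrite !inE (negPf vA) orbF => /eqP.
Qed.

End SetSystems.

(** * The exact inequality between the numbers of edges and of shadow sets *)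

Section ShadowBound.
Variable R : rcfType.

Lemma bernoulli_ineq (u : R) n : 0 <= u -> 1 + n%:R * (u - 1) <= u ^+ n.
Proof.
move=> u0; elim: n => [|n IHn]; first by rewrite mul0r addr0.
rewrite exprS; apply: le_trans (ler_wpM2l u0 IHn).
rewrite -subr_ge0 -natr1.
have -> : u * (1 + n%:R * (u - 1)) - (1 + (n%:R + 1) * (u - 1)) =
  n%:R * (u - 1) ^+ 2 by ring.
by rewrite mulr_ge0 ?sqr_ge0.
Qed.

Lemma root_exists (x : R) n : 0 <= x -> exists2 t : R, 0 <= t & t ^+ n.+1 = x.
Proof.
move=> x0; have x1 : 1 <= 1 + x by rewrite lerDl.
(* The right end [1 + x] is at least 1, so its power is at least [1 + x], hence at least [x]. *)
have [||t /andP[t0 _]] := @poly_ivt _ ('X^(n.+1) - x%:P) 0 (1 + x).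
- exact: le_trans x1.
- rewrite !hornerE expr0n sub0r oppr_le0 x0 subr_ge0 /=.
  by apply: le_trans (ler_eXnr _ x1); rewrite // lerDr.
by rewrite rootE !hornerE subr_eq0 => /eqP; exists t.
Qed.

(** This is Bernoulli's inequality at [s / t] with exponent [n.+2], multiplied by [s ^+ n * t]. *)
Lemma bernoulli_hom (s t : R) n : 0 <= s -> 0 < t ->
  n.+2%:R * s ^+ n.+1 <= t * (n.+1%:R * s ^+ n) + (s ^+ n.+1) ^+ 2 / t ^+ n.+1.
Proof.
move=> s0 t0; have t0' : t != 0 by rewrite gt_eqF.
have c0 : 0 <= s ^+ n * t by rewrite mulr_ge0 ?exprn_ge0// ltW.
have h := @bernoulli_ineq (s / t) n.+2 (divr_ge0 s0 (ltW t0)).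
rewrite -subr_ge0 in h; rewrite -subr_ge0.
apply: le_trans (mulr_ge0 c0 h) _; rewrite le_eqVlt; apply/orP; left; apply/eqP.
rewrite expr_div_n !exprS -!(natr1 n.+1) -(natr1 n); field.
by rewrite t0' expf_neq0.
Qed.

(* [t] is the real (k+1)-st root of [#|H|]; with degrees [d v] the induction
   hypothesis for [link v H] and Bernoulli's inequality at [d v ^ (1/k) / t]
   combine into the estimate [local], which is then summed over [v]. *)
Lemma shadow_bound (T : finType) k (H : {set {set T}}) (t : R) :
  uniform k.+1 H -> cancellative H -> H != set0 -> 0 <= t ->
  t ^+ k.+1 = #|H|%:R -> k.+1%:R * t ^+ k <= #|shadow_set k H|%:R.
Proof.
elim: k H t => [|k IHk] H t uH cH H0 t0 tH.
  (* For [k = 0] the bound only asks for a nonempty shadow, and the empty set belongs to it. *)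
  rewrite expr0 mul1r ler1n card_gt0; apply/set0Pn; exists set0.
  rewrite inE cards0 eqxx; have [B BH] := set0Pn _ H0.
  by apply/existsP; exists B; rewrite BH sub0set.
have {}t0 : 0 < t.
  rewrite lt_neqAle t0 andbT eq_sym; apply/negP => /eqP t00.
  by move: tH; rewrite t00 exprS mul0r => /eqP; rewrite eq_sym pnatr_eq0 cards_eq0 (negPf H0).
pose d v : R := #|link v H|%:R.
pose e v : R := #|link v (shadow_set k.+1 H)|%:R.
pose S : R := #|shadow_set k.+1 H|%:R.
have local v : k.+2%:R * d v <= t * e v + d v ^+ 2 / t ^+ k.+1.
  have [L0|L0] := eqVneq (link v H) set0.
    rewrite /d L0 cards0 mulr0 expr0n mul0r addr0 mulr_ge0// ?ltW//.
  have [s s0 sd] := @root_exists (d v) k (ler0n _ _).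
  rewrite -sd; apply: le_trans (bernoulli_hom _ s0 t0) _.
  rewrite lerD2r ler_pM2l//.
  apply: le_trans (IHk _ s (link_uniform uH) (link_cancellative cH) L0 s0 sd) _.
  by rewrite ler_nat subset_leq_card ?shadow_link_sub.
have sum_d : \sum_v d v = k.+2%:R * t ^+ k.+2.
  by rewrite -natr_sum (sum_card_link uH) natrM tH.
have sum_e : \sum_v e v = k.+1%:R * S.
  rewrite -natr_sum (@sum_card_link _ k.+1) ?natrM//.
  by move=> A; rewrite inE => /andP[/eqP].
(* By [sum_link] the sum of squares is a sum over edges [E] of the degrees in [E], each such sum
   being at most [S]; there are [t ^+ k.+2] edges. *)
have sum_d2 : \sum_v d v ^+ 2 <= t ^+ k.+2 * S.
  under eq_bigr => v _ do rewrite expr2 -natrM.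
  rewrite -natr_sum sum_link tH -natrM ler_nat -sum1_card big_distrl /=.
  by apply: leq_sum => E EH; rewrite mul1n (sum_edge_link uH).
have : \sum_v (k.+2%:R * d v) <= \sum_v (t * e v + d v ^+ 2 / t ^+ k.+1).
  by apply: ler_sum => v _.
rewrite big_split /= -!mulr_sumr -mulr_suml sum_d sum_e => h.
have tk0 : 0 < t ^+ k.+1 by rewrite exprn_gt0.
have h2 : (\sum_v d v ^+ 2) / t ^+ k.+1 <= t * S.
  by rewrite ler_pdivrMr// (le_trans sum_d2)// exprS mulrAC.
(* The summed estimate reads (k+2)^2 t^(k+2) <= (k+1) t S + t S, which is the goal times (k+2) t. *)
rewrite -(@ler_pM2l _ (k.+2%:R * t)) ?mulr_gt0 ?ltr0n//.
move: (le_trans h (lerD (lexx _) h2)); rewrite -/S !exprS -(natr1 k.+1); nra.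
Qed.

(** Raising to the power [k.+2] eliminates the root [t] and leaves a polynomial inequality between
    counts, ready for limits. *)
Lemma shadow_bound_expn (T : finType) k (H : {set {set T}}) :
  uniform k.+2 H -> cancellative H ->
  k.+2%:R ^+ k.+2 * #|H|%:R ^+ k.+1 <= #|shadow_set k.+1 H|%:R ^+ k.+2 :> R.
Proof.
move=> uH cH; have [->|H0] := eqVneq H set0.
  by rewrite cards0 expr0n mulr0 exprn_ge0.
have [t t0 tH] := @root_exists #|H|%:R k.+1 (ler0n _ _).
rewrite -tH exprAC -exprMn lerXn2r ?nnegrE ?mulr_ge0 ?exprn_ge0//.
exact: shadow_bound.
Qed.

End ShadowBound.

(** * Cancellation and the forbidden family *)

Lemma edges_uniform r (H : rgraph r) : uniform r (edges H).
Proof. by move=> A /edges_card. Qed.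

Lemma card_set3 (T : finType) (a b c : T) :
  (#|[set a; b; c]| == 3) = [&& a != b, a != c & b != c].
Proof.
rewrite setUC cardsU1 cards2 !inE (eq_sym c a) (eq_sym c b).
by case: (a == b); case: (a == c); case: (b == c).
Qed.

(** A violating triple lies in [(A :&: B) :|: C], because the symmetric difference is inside [C]. As
    [A] is not contained in [B], this set has at most (r-1) + r vertices, so the triple restricted
    to it is a forbidden r-graph. *)
Lemma free_cancellative r (H : rgraph r) :
  family_free (@cancel_family r) H -> cancellative (edges H).
Proof.
move=> freeH A B C AH BH CH sABC; apply/eqP/negP => /negP neqAB.
have [cA cB cC] : [/\ #|A| = r, #|B| = r & #|C| = r] by rewrite !edges_card.
have subE (X Y : {set vertex H}) : #|X| = r -> #|Y| = r -> X \subset Y -> X = Y.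
  by move=> cX cY sXY; apply/eqP; rewrite eqEcard sXY cX cY leqnn.
(* If [A = C], then [B :\: A] lies in [A], so [B] is inside [A] and equal sizes give [A = B];
   [B = C] is symmetric. *)
have neqAC : A != C.
  apply: contraNneq neqAB => eqAC; apply/eqP/esym/subE => //.
  apply/subsetP => x xB; apply/negP => /negP xA; move/subsetP: sABC => /(_ x).
  by rewrite !inE xA xB -eqAC => /(_ isT); apply/negP.
have neqBC : B != C.
  apply: contraNneq neqAB => eqBC; apply/eqP/subE => //.
  apply/subsetP => x xA; apply/negP => /negP xB; move/subsetP: sABC => /(_ x).
  by rewrite !inE xA xB -eqBC => /(_ isT); apply/negP.
pose U := (A :&: B) :|: C.
have sAU : A \subset U.
  apply/subsetP => x xA; rewrite !inE xA /=; case: (boolP (x \in B)) => //= xB.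
  by apply: (subsetP sABC); rewrite !inE xA xB.
have sBU : B \subset U.
  apply/subsetP => x xB; rewrite !inE xB andbT; case: (boolP (x \in A)) => //= xA.
  by apply: (subsetP sABC); rewrite !inE xA xB.
have sCU : C \subset U by exact: subsetUr.
have cU : (#|U| <= 2 * r - 1)%N.
  have : (#|A :&: B| < #|A|)%N.
    rewrite proper_card// properE subsetIl subsetI subxx /=.
    by apply: contra neqAB => sAB; apply/eqP/subE.
  have [+ _] := leq_card_setU (A :&: B) C; rewrite -/U cA cC; lia.
(* The forbidden copy lives on the subtype of [U], embedded by [val]. *)
pose pre (X : {set vertex H}) := [set u : {x | x \in U} | val u \in X].
have preK (X : {set vertex H}) : X \subset U -> val @: pre X = X.
  move=> sXU; apply/setP => x; apply/imsetP/idP => [[u]|xX].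
    by rewrite inE => uX ->.
  by exists (Sub x (subsetP sXU _ xX)); rewrite ?inE.
have card_pre (X : {set vertex H}) : X \subset U -> #|pre X| = #|X|.
  by move=> /preK {2}<-; rewrite card_imset//; exact: val_inj.
have edge_pre (e : {set {x | x \in U}}) :
    e \in [set pre A; pre B; pre C] -> #|e| = r.
  by rewrite !inE -orbA => /or3P[] /eqP->; rewrite card_pre.
apply: (freeH (RGraph edge_pre)).
  split; first by rewrite card_sig.
  exists (pre A), (pre B), (pre C); split=> //=.
    apply/eqP; rewrite card_set3; apply/and3P; split.
    - by apply: contra neqAB => /eqP e; rewrite -(preK A)// e preK.
    - by apply: contra neqAC => /eqP e; rewrite -(preK A)// e preK.
    - by apply: contra neqBC => /eqP e; rewrite -(preK B)// e preK.
  apply/subsetP => u; rewrite !inE => uAB.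
  by apply: (subsetP sABC); rewrite !inE.
exists val; split; first exact: val_inj.
by move=> e; rewrite !inE -orbA => /or3P[] /eqP->; rewrite preK.
Qed.

(** Take [x] in [A] outside [B]. The r vertices of [B] use every colour, so some [y] in [B] has the
    colour of [x], and [y] is not in [A]. Both lie in the symmetric difference, hence in [C], where
    colours are distinct. *)
Lemma rpartite_free r (H : rgraph r) (c : vertex H -> 'I_r) :
  (forall A, A \in edges H -> {in A &, injective c}) ->
  family_free (@cancel_family r) H.
Proof.
move=> injc G [_ [A [B [C [EG cG sABC]]]]] [f [injf fG]].
have /and3P[neqAB _ _] : [&& A != B, A != C & B != C].
  by rewrite -card_set3 -EG cG.
have [AG BG CG] : [/\ A \in edges G, B \in edges G & C \in edges G].
  by rewrite EG !inE !eqxx !orbT.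
have injcf X : X \in edges G -> {in X &, injective (c \o f)}.
  move=> XG x y xX yX /= /injc; move=> /(_ _ (fG _ XG)) h.
  by apply: injf; apply: h; rewrite imset_f.
have /subsetPn[x xA xB] : ~~ (A \subset B).
  apply: contra neqAB => sAB.
  by rewrite eqEcard sAB (edges_card AG) (edges_card BG) leqnn.
have /imsetP[y yB cxy] : (c \o f) x \in (c \o f) @: B.
  suff -> : (c \o f) @: B = setT by rewrite inE.
  apply/eqP; rewrite eqEcard subsetT cardsT card_ord.
  by rewrite (card_in_imset (injcf _ BG)) (edges_card BG) leqnn.
have neqxy : x != y by apply: contraNneq xB => ->.
have yA : y \notin A.
  by apply: contra neqxy => yA; rewrite (injcf _ AG _ _ xA yA cxy).
move/negP: neqxy; apply; apply/eqP; apply: (injcf _ CG) => //.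
  by apply: (subsetP sABC); rewrite !inE xA xB.
by apply: (subsetP sABC); rewrite !inE yB yA orbT.
Qed.

(** * Complete multipartite r-graphs with isolated vertices *)

Section CompletePartite.
Variables (T : finType) (D : {set T}) (p : nat).

Definition transversal_of (f : {ffun 'I_p.+1 -> T}) : {set 'I_p.+1 * T} :=
  [set (i, f i) | i : 'I_p.+1].

Lemma mem_transversal f v : (v \in transversal_of f) = (v.2 == f v.1).
Proof.
apply/imsetP/eqP => [[i _ ->]//|]; case: v => i x /= ->.
by exists i.
Qed.

Lemma card_transversal f : #|transversal_of f| = p.+1.
Proof. by rewrite card_imset ?cardsT ?card_ord// => i j []. Qed.

(** Vertices with second component outside [D] are isolated; the ratio of [#|D|] to [#|T|] tunes the
    densities. *)
Definition partite_edges : {set {set 'I_p.+1 * T}} :=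
  [set transversal_of f | f in ffun_on (mem D)].

Fact partite_edges_card e : e \in partite_edges -> #|e| = p.+1.
Proof. by case/imsetP => f _ ->; exact: card_transversal. Qed.

Definition complete_partite : rgraph p.+1 := RGraph partite_edges_card.

Lemma complete_partite_free : family_free (@cancel_family p.+1) complete_partite.
Proof.
apply: (@rpartite_free _ complete_partite fst) => A /imsetP[f _ ->] [i x] [j y].
by rewrite !mem_transversal /= => /eqP-> /eqP-> ->.
Qed.

Lemma card_complete_partite : #|edges complete_partite| = (#|D| ^ p.+1)%N.
Proof.
rewrite card_imset; first by rewrite card_ffun_on card_ord.
move=> f g /setP efg; apply/ffunP => i; apply/eqP.
by have := efg (i, f i); rewrite !mem_transversal /= eqxx => <-.
Qed.

(** A shadow set is determined by the one part it misses and its choice of vertices in the other [p]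
    parts, which [lift] enumerates. *)
Lemma shadow_complete_partite_le :
  (#|shadow complete_partite| <= p.+1 * #|D| ^ p)%N.
Proof.
pose X := setX [set: 'I_p.+1] [set g : {ffun 'I_p -> T} | g \in ffun_on (mem D)].
have <- : #|X| = (p.+1 * #|D| ^ p)%N.
  by rewrite cardsX cardsT card_ord cardsE card_ffun_on card_ord.
pose F (u : 'I_p.+1 * {ffun 'I_p -> T}) : {set 'I_p.+1 * T} :=
  [set (lift u.1 j, u.2 j) | j : 'I_p].
apply: leq_trans (leq_imset_card F X); apply/subset_leq_card/subsetP => A.
rewrite inE => /andP[/eqP/= cA /existsP[_ /andP[/imsetP[f fD ->] sAf]]].
have [v vf vA] : exists2 v, v \in transversal_of f & v \notin A.
  by apply/subsetPn; apply/negP => /subset_leq_card; rewrite card_transversal cA ltnn.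
apply/imsetP; exists (v.1, [ffun j => f (lift v.1 j)]).
  rewrite !inE /=; apply/ffun_onP => j; rewrite ffunE.
  exact: (ffun_onP fD).
apply/eqP; rewrite eqEcard cA card_imset ?cardsT ?card_ord ?leqnn ?andbT; last first.
  by move=> i j /(congr1 fst) /lift_inj.
apply/subsetP => -[i x] ixA; have := subsetP sAf _ ixA.
rewrite mem_transversal /= => /eqP ex; rewrite ex in ixA *.
have [j ij|iv] := unliftP v.1 i.
  by apply/imsetP; exists j => //=; rewrite ffunE -ij.
move: vA; rewrite mem_transversal in vf; case: v vf iv => [i' x'] /= /eqP -> iv.
by rewrite -iv ixA.
Qed.

(** The lower bound is [shadow_bound] at [t = #|D|], as there are [#|D| ^ p.+1] edges. *)
Lemma shadow_complete_partite (R : rcfType) : (0 < p)%N ->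
  #|shadow complete_partite|%:R = p.+1%:R * #|D|%:R ^+ p :> R.
Proof.
move=> p0; apply/eqP; rewrite eq_le; apply/andP; split.
  by rewrite -natrX -natrM ler_nat shadow_complete_partite_le.
(* Without edges [shadow_bound] does not apply, but the right side is then 0 since [p] is
   positive. *)
have [D0|D0] := eqVneq #|D| 0%N.
  by rewrite D0 expr0n gtn_eqF// mulr0 ler0n.
apply: (shadow_bound (@edges_uniform _ complete_partite)).
- exact/free_cancellative/complete_partite_free.
- by rewrite -card_gt0 card_complete_partite expn_gt0 lt0n D0.
- exact: ler0n.
- by rewrite card_complete_partite natrX.
Qed.

End CompletePartite.

From mathcomp Require Import all_classical all_reals all_analysis.

Import numFieldNormedType.Exports.
Local Open Scope classical_set_scope.

(** * Limits of densities *)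

Section Densities.
Variable R : realType.

Lemma cvg_exprn (u : nat -> R) (l : R) j :
  u n @[n --> \oo] --> l -> u n ^+ j @[n --> \oo] --> l ^+ j.
Proof.
move=> ul; apply: (@continuous_cvg _ _ _ _ _ _ (fun z : R => z ^+ j)) => //.
exact: exprn_continuous.
Qed.

Lemma cvg_natr_inv : (n%:R^-1 : R) @[n --> \oo] --> (0 : R).
Proof.
apply/(@gtr0_cvgV0 R); last exact: cvgr_idn.
by near=> n; rewrite ltr0n; near: n; exact: nbhs_infty_gt.
Unshelve. all: by end_near. Qed.

(** Each further factor of the falling factorial, divided by [n], is 1 - j/n and tends to 1. *)
Lemma cvg_bin_expn j : ('C(n, j)%:R / n%:R ^+ j : R) @[n --> \oo] --> (j`!%:R^-1 : R).
Proof.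
have f0 : j`!%:R != 0 :> R by rewrite pnatr_eq0 -lt0n fact_gt0.
have ffact_cvg : ((n ^_ j)%:R / n%:R ^+ j : R) @[n --> \oo] --> (1 : R).
  elim: {f0} j => [|j IHj].
    under eq_fun => n do rewrite ffactn0 expr0 divr1.
    exact: cvg_cst.
  have step : (1 - j%:R * n%:R^-1 : R) @[n --> \oo] --> (1 : R).
    rewrite -[X in _ --> X]subr0 -[X in _ --> _ - X](mulr0 j%:R).
    by apply: cvgB; [exact: cvg_cst|apply: cvgMl_tmp; exact: cvg_natr_inv].
  rewrite -[X in _ --> X]mulr1; apply: cvg_trans (cvgM IHj step).
  apply: near_eq_cvg; near=> n.
  have n0 : (0 < n)%N by near: n; exact: nbhs_infty_gt.
  have jn : (j <= n)%N by near: n; exact: nbhs_infty_ge.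
  have n0' : n%:R != 0 :> R by rewrite pnatr_eq0 -lt0n.
  by rewrite /= ffactnSr natrM natrB// exprSr; field; rewrite n0' expf_neq0.
rewrite -[X in _ --> X]mul1r.
under eq_fun => n.
  rewrite -(mulfK f0 'C(n, j)%:R) -natrM bin_ffact mulrAC; over.
by apply: cvgM => //; exact: cvg_cst.
Unshelve. all: by end_near. Qed.

Lemma cvg_truncn_ratio (b : R) : 0 <= b ->
  ((Num.truncn (b * n%:R))%:R / n%:R : R) @[n --> \oo] --> b.
Proof.
move=> b0; apply: (@squeeze_cvgr _ _ _ _ (fun n => b - n%:R^-1) (fun=> b)).
- near=> n; have n0 : 0 < n%:R :> R.
    by rewrite ltr0n; near: n; exact: nbhs_infty_gt.
  have /andP[lo hi] := truncn_itv (mulr_ge0 b0 (ler0n R n)).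
  rewrite ler_pdivrMr// lo andbT ler_pdivlMr// mulrBl mulVf ?gt_eqF//.
  by rewrite lerBlDr natr1 ltW.
- rewrite -[X in _ --> X]subr0.
  by apply: cvgB; [exact: cvg_cst|exact: cvg_natr_inv].
- exact: cvg_cst.
Unshelve. all: by end_near. Qed.

Lemma powR_invnK (z : R) n : 0 <= z -> (z `^ n.+1%:R^-1) ^+ n.+1 = z.
Proof. by move=> z0; rewrite -powR_mulrn ?powR_ge0// -powRrM mulVf ?powRr1. Qed.

Lemma edge_density_ge0_le1 r (H : rgraph r) : 0 <= edge_density R H <= 1.
Proof.
rewrite /edge_density divr_ge0//=.
have le : (#|edges H| <= 'C(#|vertex H|, r))%N.
  rewrite -card_draws; apply/subset_leq_card/fintype.subsetP => A /edges_card cA.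
  by rewrite inE cA.
have [->|C0] := eqVneq 'C(#|vertex H|, r) 0%N; first by rewrite invr0 mulr0.
by rewrite ler_pdivrMr ?ltr0n ?lt0n// mul1r ler_nat.
Qed.

Lemma shadow_density_ge0_le1 r (H : rgraph r) : 0 <= shadow_density R H <= 1.
Proof.
rewrite /shadow_density divr_ge0//=.
have le : (#|shadow H| <= 'C(#|vertex H|, r.-1))%N.
  rewrite -card_draws; apply/subset_leq_card/fintype.subsetP => A.
  by rewrite !inE => /andP[].
have [->|C0] := eqVneq 'C(#|vertex H|, r.-1) 0%N; first by rewrite invr0 mulr0.
by rewrite ler_pdivrMr ?ltr0n ?lt0n// mul1r ler_nat.
Qed.

Lemma cvg_itv01 (u : nat -> R) (l : R) : (forall n, 0 <= u n <= 1) ->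
  u n @[n --> \oo] --> l -> 0 <= l <= 1.
Proof.
move=> u01 ul; apply/andP; split.
  by apply: cvgr_to_ge ul _; near=> n; case/andP: (u01 n).
by apply: cvgr_to_le ul _; near=> n; case/andP: (u01 n).
Unshelve. all: by end_near. Qed.

(** With r = q+2, both sides of the counting bound scale as n^(r(r-1)). The limit is r^r
    (y/r!)^(r-1) <= (x/(r-1)!)^r, and r! = r (r-1)! collapses the constants. *)
Lemma feasible_bound q (x y : R) :
  feasible_region (@cancel_family q.+2) (x, y) -> y ^+ q.+1 <= x ^+ q.+2 / q.+2`!%:R.
Proof.
case=> _ _ [H [[Hv _ _] freeH [/= Hx Hy]]].
pose n k := #|vertex (H k)|.
pose c j k : R := 'C(n k, j)%:R / (n k)%:R ^+ j.
have cvg_c j : c j k @[k --> \oo] --> (j`!%:R^-1 : R).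
  exact: (cvg_comp _ _ Hv (@cvg_bin_expn j)).
set X := fun k => shadow_density R (H k) in Hx.
set Y := fun k => edge_density R (H k) in Hy.
have lim : q.+2%:R ^+ q.+2 * (y * q.+2`!%:R^-1) ^+ q.+1 <=
    (x * q.+1`!%:R^-1) ^+ q.+2 :> R.
  have cvgL : q.+2%:R ^+ q.+2 * (Y k * c q.+2 k) ^+ q.+1 @[k --> \oo] -->
      q.+2%:R ^+ q.+2 * (y * q.+2`!%:R^-1) ^+ q.+1.
    by apply: cvgMl_tmp; apply: cvg_exprn; exact: cvgM.
  have cvgR : (X k * c q.+1 k) ^+ q.+2 @[k --> \oo] --> (x * q.+1`!%:R^-1) ^+ q.+2.
    by apply: cvg_exprn; exact: cvgM.
  apply: ler_cvg_to cvgL cvgR _; near=> k.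
  (* This keeps the binomials nonzero, so that density times [c] recovers the count over a power of
     [n k]. *)
  have nk : (q.+2 <= n k)%N by near: k; move/cvgnyPge: Hv; apply.
  have n0 : 0 < (n k)%:R :> R by rewrite ltr0n (leq_trans _ nk).
  have eY : Y k * c q.+2 k = #|edges (H k)|%:R / (n k)%:R ^+ q.+2.
    by rewrite /Y /c /edge_density mulrA divfK// pnatr_eq0 -lt0n bin_gt0.
  have eX : X k * c q.+1 k = #|shadow (H k)|%:R / (n k)%:R ^+ q.+1.
    rewrite /X /c /shadow_density mulrA divfK// pnatr_eq0 -lt0n bin_gt0.
    exact: ltnW.
  rewrite eY eX !expr_div_n -!exprM mulrA (mulnC q.+1) ler_pM2r ?invr_gt0 ?exprn_gt0//.
  exact: (shadow_bound_expn R (@edges_uniform _ (H k)) (free_cancellative (freeH k))).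
have f0 j : 0 < j`!%:R :> R by rewrite ltr0n fact_gt0.
have eF : q.+2`!%:R = q.+2%:R * q.+1`!%:R :> R by rewrite factS natrM.
rewrite ler_pdivlMr//; move: lim; rewrite !expr_div_n mulrA ler_pdivlMr ?exprn_gt0//.
congr (_ <= _); rewrite eF exprMn !exprS; field.
by rewrite !expf_neq0 ?gt_eqF//= pnatr_eq0.
Unshelve. all: by end_near. Qed.

(** Realized by r = q+2 parts of size [k], each with about b k non-isolated vertices. *)
Lemma feasible_complete_partite q (b : R) : 0 <= b <= 1 ->
  feasible_region (@cancel_family q.+2)
    (q.+2%:R * (b ^+ q.+1 * q.+1`!%:R / q.+2%:R ^+ q.+1),
     b ^+ q.+2 * q.+2`!%:R / q.+2%:R ^+ q.+2).
Proof.
move=> /andP[b0 b1].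
pose m k := Num.truncn (b * k%:R).
pose D k : {set 'I_k} := [set j : 'I_k | (j < m k)%N]%SET.
pose H k := complete_partite (D k) q.+1.
have cD k : #|D k| = m k.
  have mk : (m k <= k)%N.
    rewrite truncn_le_nat; apply: (@le_lt_trans _ _ k%:R); last by rewrite ltr_nat.
    by rewrite ler_piMl.
  by rewrite -sum1dep_card -(big_ord_widen _ (fun=> 1%N) mk) sum1_card card_ord.
have cV k : #|vertex (H k)| = (q.+2 * k)%N by rewrite card_prod !card_ord.
have Hv : #|vertex (H k)| @[k --> \oo] --> \oo.
  apply/cvgnyPge => A; near=> k; rewrite cV.
  by apply: leq_trans (leq_pmull _ _) => //; near: k; exact: nbhs_infty_ge.
(* Serves both densities: with n = r k, the quotient is (m/k)^j divided by C(n,j)/n^j and by r^j. *)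
have lim j : (0 < j <= q.+2)%N ->
    (m k)%:R ^+ j / 'C(#|vertex (H k)|, j)%:R @[k --> \oo] -->
    (b ^+ j * j`!%:R / q.+2%:R ^+ j : R).
  move=> /andP[j0 jq].
  have f0 : j`!%:R^-1 != 0 :> R by rewrite invr_eq0 pnatr_eq0 -lt0n fact_gt0.
  have cvg_c := @cvg_comp _ _ _ (fun k => #|vertex (H k)|)
    (fun n => 'C(n, j)%:R / n%:R ^+ j : R) _ _ _ Hv (@cvg_bin_expn j).
  have cvg_m := @cvg_exprn _ _ j (@cvg_truncn_ratio b b0).
  rewrite -[X in _ * X / _]invrK.
  apply: cvg_trans (cvgM (cvgM cvg_m (cvgV f0 cvg_c)) (@cvg_cst R (q.+2%:R ^- j) _ \oo _)).
  apply: near_eq_cvg; near=> k.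
  have k0 : k%:R != 0 :> R by rewrite pnatr_eq0 -lt0n; near: k; exact: nbhs_infty_gt.
  have C0 : 'C(q.+2 * k, j)%:R != 0 :> R.
    rewrite pnatr_eq0 -lt0n bin_gt0 (leq_trans jq)// leq_pmulr// lt0n.
    by rewrite -(pnatr_eq0 R).
  rewrite /= cV -/(m k) natrM !expr_div_n exprMn; field.
  by rewrite C0 !expf_neq0// pnatr_eq0.
have Hx : shadow_density R (H k) @[k --> \oo] -->
    q.+2%:R * (b ^+ q.+1 * q.+1`!%:R / q.+2%:R ^+ q.+1).
  under eq_fun => k.
    rewrite /shadow_density shadow_complete_partite// cD -mulrA; over.
  by apply: cvgMl_tmp; apply: lim; rewrite leqnSn.
have Hy : edge_density R (H k) @[k --> \oo] -->
    b ^+ q.+2 * q.+2`!%:R / q.+2%:R ^+ q.+2.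
  under eq_fun => k.
    rewrite /edge_density card_complete_partite cD natrX; over.
  by apply: lim; rewrite leqnn.
split.
- exact: (cvg_itv01 (fun k => shadow_density_ge0_le1 (H k)) Hx).
- exact: (cvg_itv01 (fun k => edge_density_ge0_le1 (H k)) Hy).
exists H; split=> //; last by move=> k; exact: complete_partite_free.
by split=> //; apply/cvg_ex; eexists; [exact: Hy|exact: Hx].
Unshelve. all: by end_near. Qed.

End Densities.

Theorem theorem1p14 (R : realType) (r : nat) (hr : (3 <= r)%N) :
  (forall x : R, feasible_proj (@cancel_family r) x ->
     feasible_max (@cancel_family r) x
       <= (x ^+ r / (r`!)%:R) `^ ((r - 1)%:R)^-1) /\
  (forall x : R, 0 <= x <= ((r - 1)`!)%:R / r%:R ^+ (r - 2) ->
     feasible_proj (@cancel_family r) x /\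
     feasible_max (@cancel_family r) x
       = (x ^+ r / (r`!)%:R) `^ ((r - 1)%:R)^-1).
Proof.
case: r hr => [|[|q]]// _; rewrite subn1 subn2 /=.
have upper (x : R) : feasible_proj (@cancel_family q.+2) x ->
    feasible_max (@cancel_family q.+2) x <= (x ^+ q.+2 / q.+2`!%:R) `^ q.+1%:R^-1.
  move=> /feasible_maxP[/= maxS _]; have [/= /andP[x0 _] /andP[y0 _] _] := maxS.
  have z0 : 0 <= x ^+ q.+2 / q.+2`!%:R by rewrite divr_ge0 ?exprn_ge0.
  rewrite -(@ler_pXn2r _ q.+1) ?nnegrE ?powR_ge0// powR_invnK//.
  exact: feasible_bound.
split=> // x /andP[x0 xle].
have f0 j : j`!%:R != 0 :> R by rewrite pnatr_eq0 -lt0n fact_gt0.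
have r0 : q.+2%:R != 0 :> R by rewrite pnatr_eq0.
(* With r = q+2, [b] solves r b^(r-1) (r-1)! / r^(r-1) = x, so the construction has limiting shadow
   density [x]; the assumed range of [x] says exactly that b <= 1. *)
have [b b0 eb] : exists2 b : R, 0 <= b & b ^+ q.+1 = x * q.+2%:R ^+ q / q.+1`!%:R.
  by apply: root_exists; rewrite divr_ge0 ?mulr_ge0 ?exprn_ge0.
have b1 : b <= 1.
  rewrite -(@ler_pXn2r _ q.+1) ?nnegrE// expr1n eb ler_pdivrMr ?ltr0n ?fact_gt0//.
  by rewrite mul1r -ler_pdivlMr ?exprn_gt0 ?ltr0n.
have := @feasible_complete_partite _ q b; rewrite b0 b1 => /(_ isT).
set y := b ^+ q.+2 * _ / _.
have -> : q.+2%:R * (b ^+ q.+1 * q.+1`!%:R / q.+2%:R ^+ q.+1) = x.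
  by rewrite eb exprS; field; rewrite expf_neq0 ?r0 ?f0//= andbT -natrD pnatr_eq0.
move=> Oxy; have Px : feasible_proj (@cancel_family q.+2) x by exists y.
split=> //; apply/eqP; rewrite eq_le upper//=.
(* The feasible [y] is at most the maximum, so it remains to check that [y] attains the bound. *)
have [_ /(_ _ Oxy)] := feasible_maxP Px; apply: le_trans.
have z0 : 0 <= x ^+ q.+2 / q.+2`!%:R by rewrite divr_ge0 ?exprn_ge0.
have y0 : 0 <= y.
  by apply: divr_ge0; [apply: mulr_ge0 => //|]; apply: exprn_ge0.
rewrite -(@ler_pXn2r _ q.+1) ?nnegrE ?powR_ge0// powR_invnK//.
suff -> : y ^+ q.+1 = x ^+ q.+2 / q.+2`!%:R by [].
have eF : q.+2`!%:R = q.+2%:R * q.+1`!%:R :> R by rewrite factS natrM.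
have eE : (q.+2%:R ^+ q.+2) ^+ q.+1 =
    (q.+2%:R ^+ q) ^+ q.+2 * q.+2%:R ^+ q.+1 * q.+2%:R :> R.
  by rewrite -!exprM -exprD -exprSr; congr (_ ^+ _); lia.
(* [exprAC] turns (b^r)^(r-1) into (b^(r-1))^r, so that [eb] eliminates [b]. *)
rewrite /y expr_div_n exprMn exprAC eb !expr_div_n exprMn eE eF exprMn.
rewrite (exprS q.+1`!%:R q.+1); field.
by rewrite !expf_neq0 ?f0 ?r0//= andbT -natrD pnatr_eq0.
Qed.
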